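(* Let $A$ be a regular system of divisors and $n\in\mathbb N$. Then for every real $x>1$, \[ \Phi_{A,n}(x)=\prod_{j=1}^n\left(x^{(j,n)_A}-1\right)^{\cos(2\pi j/n)}. \]
   Context: A regular system of divisors is a family $A=(A(n))_{n\in\mathbb N}$, where each $A(n)$ is a set of positive divisors of $n$, such that: (i) $A(1)=\{1\}$ and $A(mn)=\{de: d\in A(m), e\in A(n)\}$ whenever $\gcd(m,n)=1$; (ii) for every prime power $p^a$ ($a\ge1$) there is a divisor $t=t_A(p^a)$ of $a$ such that $A(p^{it})=\{1,p^t,\dots,p^{it}\}$ for every $0\le i\le a/t$. For $j\in\mathbb Z$, $(j,n)_A=\max\{d\in\mathbb N: d\mid j,\ d\in A(n)\}$; $\zeta_n=e^{2\pi i/n}$; $\Phi_{A,n}(x)=\prod_{1\le j\le n,\ (j,n)_A=1}(x-\zeta_n^j)$. *)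

(* Defs.v *)
From HB Require Import structures.
From mathcomp Require Import all_boot all_order all_algebra.
From mathcomp Require Import finmap.
From mathcomp Require Import boolp classical_sets reals topology normedtype.
From mathcomp Require Import sequences exp trigo.
From mathcomp Require Import complex.

Set Implicit Arguments.
Unset Strict Implicit.
Unset Printing Implicit Defensive.

Import Order.TTheory GRing.Theory Num.Theory.

(* The positive integers are represented by nat, so the (meaningless) set A 0
   is left unconstrained: every clause is restricted to positive arguments. *)
Definition regular_system (A : nat -> {fset nat}) : Prop :=
  [/\ (forall n d : nat, 0 < n -> d \in A n -> d %| n),
      A 1 = [fset 1]%fset,
      (forall m n : nat, 0 < m -> 0 < n -> coprime m n ->
         A (m * n) = [fset d * e | d in A m, e in A n]%fset)
    & (forall p a : nat, prime p -> 0 < a ->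
         exists t : nat, t %| a /\
           forall i : nat, i <= a %/ t ->
             A (p ^ (i * t)) = [fset p ^ (k * t) | k in iota 0 i.+1]%fset)].

(* (j, n)_A; for a regular system and n > 0 the range contains d = 1, so the
   default value 0 of an empty maximum never occurs. *)
Definition gcdA (A : nat -> {fset nat}) (j : int) (n : nat) : nat :=
  \max_(d <- A n | (d%:Z %| j)%Z) d.

Local Open Scope ring_scope.
Local Open Scope complex_scope.

(* exp(2 i pi / n), written in Cartesian form as there is no complex
   exponential on R[i]. *)
Definition zeta (R : realType) (n : nat) : R[i] :=
  cos (2 * pi / n%:R) +i* sin (2 * pi / n%:R).

Definition PhiA (R : realType) (A : nat -> {fset nat}) (n : nat) :
    {poly R[i]} :=
  \prod_(1 <= j < n.+1 | gcdA A j%:Z n == 1%N) ('X - (zeta R n ^+ j)%:P).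

(* Main.v *)
Require Import Defs.
From HB Require Import structures.
From mathcomp Require Import all_boot all_order all_algebra.
From mathcomp Require Import finmap.
From mathcomp Require Import boolp classical_sets reals topology normedtype.
From mathcomp Require Import sequences exp trigo.
From mathcomp Require Import complex.
From mathcomp Require Import ring lra.

(* Sorting 1 <= j <= n by d = (j, n)_A, with j = d k and (k, n/d)_A = 1, gives
   prod_(d in A n) Phi_(A,d)(x) = x^n - 1.  Put c(m) for the sum of
   cos(2 pi k/m) over (k, m)_A = 1.  The same sorting shows that c sums over
   A(m) to [m = 1], and that the cosine product P(n) equals
   prod_(d in A n) (x^d - 1)^c(n/d); hence prod_(d in A n) P(d) = x^n - 1 as
   well.  Since n belongs to A(n), this recursion determines Phi_(A,n)(x) = P(n)
   by strong induction, all factors being nonzero. *)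

Set Implicit Arguments.
Unset Strict Implicit.
Unset Printing Implicit Defensive.

Import Order.TTheory GRing.Theory Num.Theory.

(** * Local structure of a regular system: prime powers, then coprime products *)

(** Besides divisibility of n, these are the only facts about A(n) used from here on. Each passes to
    coprime products, so prime powers suffice. [Adiv_gcd] asks for a greatest element in the order
    of divisibility, not merely of size. *)
Record divisor_system_at (A : nat -> {fset nat}) (n : nat) : Prop := {
  Adiv_self : n \in A n;
  Adiv_compl : forall d, d \in A n -> n %/ d \in A n;
  Adiv_sub : forall d e, d \in A n -> (e \in A d) = (e \in A n) && (e %| d);
  Adiv_gcd : forall j, 0 < j -> exists g,
    [/\ g \in A n, g %| j & forall d, d \in A n -> d %| j -> d %| g] }.

(** With s = a/t, A(p^a) is the chain of all p^(kt), k <= s: divisibility compares the indices k,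
    and taking complements is k -> s - k. *)
Lemma divisor_system_at_pfactor A p a : regular_system A -> prime p -> 0 < a ->
  divisor_system_at A (p ^ a).
Proof.
move=> [_ _ _ /(_ p a)]H pr_p a_gt0; have [t [dv_t Ht]] := H pr_p a_gt0.
have t_gt0 : 0 < t by apply: dvdn_gt0 dv_t.
have p_gt0 := prime_gt0 pr_p; have p_gt1 := prime_gt1 pr_p.
have {}Ht i d : i <= a %/ t ->
    reflect (exists2 k, k <= i & d = p ^ (k * t)) (d \in A (p ^ (i * t))).
  move=> /Ht ->; apply: (iffP (imfsetP _ _ _ _)) => -[k].
    move=> Hk ->; exists k => //.
    by move: (Hk : k \in iota 0 i.+1); rewrite mem_iota.
  move=> Hk ->; exists k => //; suff: k \in iota 0 i.+1 by [].
  by rewrite mem_iota.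
move: (a %/ t) (divnK dv_t) Ht => s <- Ht {H a_gt0 dv_t a}.
have HA d := Ht s d (leqnn s).
split.
- by apply/HA; exists s.
- move=> d /HA[k le_ks ->]; apply/HA; exists (s - k); first exact: leq_subr.
  by rewrite mulnBl expnB // leq_mul2r le_ks orbT.
- move=> d e /HA[k le_ks ->]; apply/Ht/andP => // -[].
    move=> l le_lk ->; split; first
      by apply/HA; exists l; rewrite ?(leq_trans le_lk).
    by rewrite dvdn_Pexp2l // leq_mul2r le_lk orbT.
  move/HA=> [l le_ls ->]; rewrite dvdn_Pexp2l // leq_pmul2r // => le_lk.
  by exists l.
(* The index is the largest k <= s such that kt does not exceed the p-adic valuation of j. *)
move=> j j_gt0; exists (p ^ (minn s (logn p j %/ t) * t)).
have dvE k : (p ^ (k * t) %| j) = (k <= logn p j %/ t).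
  by rewrite pfactor_dvdn // leq_divRL.
split; first by apply/HA; exists (minn s (logn p j %/ t)); rewrite ?geq_minl.
  by rewrite dvE geq_minr.
move=> d /HA[k le_ks ->]; rewrite dvE => le_k.
by rewrite dvdn_Pexp2l // leq_pmul2r // leq_min le_ks.
Qed.

Lemma dvdn_coprime_mul m n d1 d2 e1 e2 : coprime m n ->
  d1 %| m -> d2 %| n -> e1 %| m -> e2 %| n ->
  (e1 * e2 %| d1 * d2) = (e1 %| d1) && (e2 %| d2).
Proof.
move=> co_mn d1m d2n e1m e2n; rewrite Gauss_dvd; last first.
  exact: coprime_dvdl e1m (coprime_dvdr e2n co_mn).
rewrite Gauss_dvdl; last exact: coprime_dvdl e1m (coprime_dvdr d2n co_mn).
rewrite Gauss_dvdr //.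
by rewrite coprime_sym; apply: coprime_dvdl d1m (coprime_dvdr e2n co_mn).
Qed.

(** Elements of A(mn) split as d1 * d2 over A(m) and A(n), and every property is checked
    componentwise; the greatest common divisors multiply because they are coprime. *)
Lemma divisor_system_at_mul A m n : regular_system A -> coprime m n ->
    0 < m -> 0 < n -> divisor_system_at A m -> divisor_system_at A n ->
  divisor_system_at A (m * n).
Proof.
move=> [Adv _ Amul _] co_mn m_gt0 n_gt0 [m1 m2 m3 m4] [n1 n2 n3 n4].
have HA a b d : 0 < a -> 0 < b -> coprime a b -> reflect
    (exists d1 d2, [/\ d1 \in A a, d2 \in A b & d = d1 * d2]) (d \in A (a * b)).
  move=> a_gt0 b_gt0 co_ab; rewrite Amul //; apply: (iffP (imfset2P _ _ _ _ _)).
    by move=> [d1 /= H1 [d2 H2 ->]]; exists d1, d2.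
  by move=> [d1 [d2 [H1 H2 ->]]]; exists d1 => //; exists d2.
have Hmn d := HA m n d m_gt0 n_gt0 co_mn.
split.
- by apply/Hmn; exists m, n.
- move=> d /Hmn[d1 [d2 [H1 H2 ->]]]; apply/Hmn.
  exists (m %/ d1), (n %/ d2); split; [exact: m2 | exact: n2 |].
  have [D1 D2] := (Adv _ _ m_gt0 H1, Adv _ _ n_gt0 H2).
  rewrite -{1}(divnK D1) -{1}(divnK D2) mulnACA mulnK // muln_gt0.
  by rewrite (dvdn_gt0 m_gt0 D1) (dvdn_gt0 n_gt0 D2).
- move=> d e /Hmn[d1 [d2 [H1 H2 ->]]].
  have [D1 D2] := (Adv _ _ m_gt0 H1, Adv _ _ n_gt0 H2).
  have d1_gt0 := dvdn_gt0 m_gt0 D1; have d2_gt0 := dvdn_gt0 n_gt0 D2.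
  have co_d := coprime_dvdl D1 (coprime_dvdr D2 co_mn).
  apply/HA/andP => // -[].
    move=> e1 [e2 []]; rewrite (m3 d1) // (n3 d2) //.
    move=> /andP[E1 E1'] /andP[E2 E2'] ->.
    by split; [apply/Hmn; exists e1, e2 | apply: dvdn_mul].
  move=> /Hmn[e1 [e2 [E1 E2 ->]]].
  rewrite (dvdn_coprime_mul co_mn D1 D2 (Adv _ _ m_gt0 E1) (Adv _ _ n_gt0 E2)).
  move=> /andP[De1 De2].
  by exists e1, e2; rewrite (m3 _ _ H1) (n3 _ _ H2) E1 E2 De1 De2.
move=> j j_gt0; have [g [G1 G2 G3]] := m4 j j_gt0.
have [h [K1 K2 K3]] := n4 j j_gt0.
exists (g * h); split; first by apply/Hmn; exists g, h.
  rewrite Gauss_dvd ?G2 //; exact: coprime_dvdl (Adv _ _ m_gt0 G1)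
    (coprime_dvdr (Adv _ _ n_gt0 K1) co_mn).
move=> d /Hmn[d1 [d2 [H1 H2 ->]]] dj; apply: dvdn_mul.
  by apply: G3 => //; apply: dvdn_trans dj; apply: dvdn_mulr.
by apply: K3 => //; apply: dvdn_trans dj; apply: dvdn_mull.
Qed.

(** Strong induction: split off the full power of the smallest prime factor; the coprime cofactor is
    strictly smaller. *)
Lemma regular_divisor_system_at A n : regular_system A -> 0 < n ->
  divisor_system_at A n.
Proof.
move=> regA; elim/ltn_ind: n => n IHn n_gt0.
have [le_n1 | n_gt1] := leqP n 1.
  have -> : n = 1 by apply/eqP; rewrite eqn_leq le_n1.
  have [_ A1 _ _] := regA; split; rewrite A1 ?inE //.
  - by move=> d; rewrite inE => /eqP ->; rewrite divn1 inE.
  - move=> d e; rewrite inE => /eqP ->; rewrite A1 inE dvdn1 andbb //.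
  - by move=> j _; exists 1; rewrite inE; split=> // d; rewrite inE => /eqP ->.
pose p := pdiv n; have pr_p : prime p := pdiv_prime n_gt1.
have lp_gt0 : 0 < logn p n by rewrite logn_gt0 pi_pdiv.
have nE := partnC p n_gt0; rewrite -nE.
have q_gt1 : 1 < n`_p.
  by rewrite p_part -(exp1n (logn p n)) ltn_exp2r // prime_gt1.
apply: divisor_system_at_mul; rewrite ?part_gt0 ?coprime_partC //.
  by rewrite p_part; apply: divisor_system_at_pfactor.
apply: IHn; last exact: part_gt0.
by rewrite -[X in _ < X]nE ltn_Pmull ?part_gt0.
Qed.

(** * Sums and products over A(n), and the generalized gcd *)

Section RegularSystem.

Variable A : nat -> {fset nat}.
Hypothesis regA : regular_system A.

Lemma Adiv_dvdn n d : 0 < n -> d \in A n -> d %| n.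
Proof. by move=> n_gt0; case: regA => Adv _ _ _; apply: Adv. Qed.

Lemma Adiv_gt0 n d : 0 < n -> d \in A n -> 0 < d.
Proof. by move=> n_gt0 /(Adiv_dvdn n_gt0); apply: dvdn_gt0. Qed.

Lemma Adiv_quo_gt0 n d : 0 < n -> d \in A n -> 0 < n %/ d.
Proof.
move=> n_gt0 And; have dn := Adiv_dvdn n_gt0 And.
by rewrite divn_gt0 ?(dvdn_gt0 n_gt0 dn) // dvdn_leq.
Qed.

(** Complements do the work. If e is in A(n/d), then so is (n/d)/e, which thus lies in A(n), and its
    complement in n is de. Conversely, d lies in A(de), hence so does its complement e, which is
    then in A(n) and divides n/d. *)
Lemma in_Adiv_quo n d e : 0 < n -> d \in A n ->
  (e \in A (n %/ d)) = (0 < e) && (d * e \in A n).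
Proof.
move=> n_gt0 And; have reg_n := regular_divisor_system_at regA n_gt0.
have d_gt0 := Adiv_gt0 n_gt0 And; have dn := Adiv_dvdn n_gt0 And.
have Anq := Adiv_compl reg_n And.
have q_gt0 := Adiv_quo_gt0 n_gt0 And.
have reg_q := regular_divisor_system_at regA q_gt0.
apply/idP/andP => [Aqe | [e_gt0 Ande]].
  have e_gt0 := Adiv_gt0 q_gt0 Aqe; split=> //.
  have: (n %/ d) %/ e \in A n.
    by have := Adiv_compl reg_q Aqe; rewrite (Adiv_sub reg_n) // => /andP[].
  move/(Adiv_compl reg_n); rewrite -divnMA divnA ?mulKn //.
  have := Adiv_dvdn q_gt0 Aqe.
  by rewrite -{2}(divnK dn) mulnC dvdn_pmul2r.
have den := Adiv_dvdn n_gt0 Ande.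
have de_gt0 : 0 < d * e by rewrite muln_gt0 d_gt0.
have reg_de := regular_divisor_system_at regA de_gt0.
have Aded : d \in A (d * e) by rewrite (Adiv_sub reg_n) // And dvdn_mulr.
have := Adiv_compl reg_de Aded.
rewrite (mulKn _ d_gt0) (Adiv_sub reg_n _ Ande) => /andP[Ane _].
by rewrite (Adiv_sub reg_n) // Ane dvdn_divRL // mulnC.
Qed.

Lemma perm_Adiv_quo n : 0 < n -> perm_eq [seq n %/ d | d <- A n] (A n).
Proof.
move=> n_gt0; have reg_n := regular_divisor_system_at regA n_gt0.
have invA d : d \in A n -> n %/ (n %/ d) = d.
  by move=> And; rewrite divnA ?mulKn // Adiv_dvdn.
apply: uniq_perm; rewrite ?fset_uniq //.
  rewrite map_inj_in_uniq ?fset_uniq // => d e And Ane E.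
  by rewrite -[d]invA // E invA.
move=> d; apply/mapP/idP => [[e Ane ->] | And]; first exact: Adiv_compl.
by exists (n %/ d); [exact: Adiv_compl | rewrite invA].
Qed.

Lemma perm_Adiv_multiples n e : 0 < n -> e \in A n ->
  perm_eq [seq d <- A n | e %| d] [seq e * f | f <- A (n %/ e)].
Proof.
move=> n_gt0 Ane; have e_gt0 := Adiv_gt0 n_gt0 Ane.
apply: uniq_perm; first by rewrite filter_uniq ?fset_uniq.
  rewrite map_inj_uniq ?fset_uniq // => f g /eqP.
  by rewrite eqn_pmul2l // => /eqP.
move=> d; rewrite mem_filter; apply/andP/mapP => [[/dvdnP[f ->] Ad] | [f Af ->]].
  have f_gt0 : 0 < f by have := Adiv_gt0 n_gt0 Ad; rewrite muln_gt0 => /andP[].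
  by exists f; rewrite ?in_Adiv_quo ?f_gt0 //= mulnC.
by move: Af; rewrite in_Adiv_quo // => /andP[_ ->]; rewrite dvdn_mulr.
Qed.

(** The maximum by size is also greatest for divisibility: the element g from [Adiv_gcd] is among
    the candidates, and every candidate divides it. *)
Lemma gcdAP j n : 0 < j -> 0 < n ->
  [/\ gcdA A j n \in A n, gcdA A j n %| j
    & forall d, d \in A n -> d %| j -> d %| gcdA A j n].
Proof.
move=> j_gt0 n_gt0; have reg_n := regular_divisor_system_at regA n_gt0.
have [g [Ag gj gmax]] := Adiv_gcd reg_n j_gt0.
suff -> : gcdA A j n = g by [].
apply/eqP; rewrite eqn_leq; apply/andP; split.
  apply/bigmax_leqP_seq => d Ad dj; apply: dvdn_leq (gmax d Ad dj).
  exact: Adiv_gt0 Ag.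
exact: (@leq_bigmax_seq _ _ _ id g Ag).
Qed.

Lemma gcdA_eqE j n d : 0 < j -> 0 < n -> d \in A n ->
  (gcdA A j n == d) = (d %| j) && (gcdA A (j %/ d)%N (n %/ d) == 1).
Proof.
move=> j_gt0 n_gt0 And; have reg_n := regular_divisor_system_at regA n_gt0.
have d_gt0 := Adiv_gt0 n_gt0 And.
have q_gt0 := Adiv_quo_gt0 n_gt0 And.
have [dj | ndj] := boolP (d %| j); last first.
  by apply/negbTE; apply: contraNneq ndj => <-; case: (gcdAP j_gt0 n_gt0).
have jd_gt0 : 0 < j %/ d by rewrite divn_gt0 // dvdn_leq.
have [Ag gj gmax] := gcdAP j_gt0 n_gt0.
have [Ah hj hmax] := gcdAP jd_gt0 q_gt0.
move: (gcdA A j n) (gcdA A _ (n %/ d)) Ag gj gmax Ah hj hmax => g h.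
move=> Ag gj gmax Ah hj hmax /=; have h_gt0 := Adiv_gt0 q_gt0 Ah.
apply/eqP/eqP => [gd | h1].
  (* dh is in A(n) and divides j, so it divides g = d, forcing h = 1. *)
  have /gmax: d * h \in A n by move: Ah; rewrite in_Adiv_quo // => /andP[].
  move: hj; rewrite dvdn_divRL // mulnC => -> /(_ isT).
  by rewrite gd -{2}[d]muln1 dvdn_pmul2l // dvdn1 => /eqP.
have dg : d %| g by apply: gmax.
have g_gt0 := Adiv_gt0 n_gt0 Ag.
have gd_gt0 : 0 < g %/ d by rewrite divn_gt0 // dvdn_leq.
(* Conversely, g/d is in A(n/d) and divides j/d, so it divides h = 1. *)
have: g %/ d %| h.
  apply: hmax; first by rewrite in_Adiv_quo // gd_gt0 mulnC divnK.
  by rewrite dvdn_divRL // divnK.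
by rewrite h1 dvdn1 => /eqP g1; rewrite -(divnK dg) g1 mul1n.
Qed.

(** The sorting of j = dk by d = (j, n)_A, over any commutative monoid so as to serve both the sums
    of cosines and the products. *)
Lemma big_gcdA_quo (T : Type) (idx : T) (op : Monoid.com_law idx) F n :
    0 < n ->
  \big[op/idx]_(1 <= j < n.+1) F j =
  \big[op/idx]_(d <- A n)
     \big[op/idx]_(1 <= k < (n %/ d).+1 | gcdA A k (n %/ d) == 1) F (d * k).
Proof.
move=> n_gt0.
transitivity (\big[op/idx]_(d <- A n)
    \big[op/idx]_(1 <= j < n.+1 | gcdA A j n == d) F j).
  under [RHS]eq_bigr do rewrite big_mkcond; rewrite exchange_big /=.
  rewrite !big_nat; apply: eq_bigr => j /andP[j_gt0 _].
  (* Each j is counted for exactly one d, since (j, n)_A belongs to A(n). *)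
  have [Ag _ _] := gcdAP j_gt0 n_gt0.
  rewrite (big_rem _ Ag) /= eqxx big1_seq ?Monoid.mulm1 // => d.
  by rewrite mem_rem_uniq ?fset_uniq // inE eq_sym => /andP[_ /andP[/negbTE ->]].
rewrite [LHS]big_seq [RHS]big_seq; apply: eq_bigr => d And.
have d_gt0 := Adiv_gt0 n_gt0 And; have dn := Adiv_dvdn n_gt0 And.
have q_gt0 := Adiv_quo_gt0 n_gt0 And.
rewrite -big_filter -[RHS]big_filter.
rewrite -(big_map (muln d) xpredT F); apply: perm_big.
apply: uniq_perm.
- by rewrite filter_uniq ?iota_uniq.
- rewrite map_inj_uniq ?filter_uniq ?iota_uniq // => f g /eqP.
  by rewrite eqn_pmul2l // => /eqP.
move=> j; rewrite mem_filter mem_index_iota.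
apply/idP/mapP => [/and3P[gj j_gt0 le_jn] | [k]].
  move: gj; rewrite gcdA_eqE // => /andP[dj gjd].
  exists (j %/ d); last by rewrite mulnC divnK.
  rewrite mem_filter gjd mem_index_iota divn_gt0 // dvdn_leq //=.
  by rewrite ltnS leq_div2r.
rewrite mem_filter mem_index_iota ltnS => /and3P[gk k_gt0 le_k] ->.
have dk_gt0 : 0 < d * k by rewrite muln_gt0 d_gt0.
by rewrite gcdA_eqE // dvdn_mulr // mulKn // gk dk_gt0 ltnS mulnC -leq_divRL.
Qed.

(** The involution d -> n/d of A(n) brings such double sums to the shape produced by
    [big_gcdA_quo]. *)
Lemma big_gcdA (T : Type) (idx : T) (op : Monoid.com_law idx)
    (G : nat -> nat -> T) n : 0 < n ->
  \big[op/idx]_(d <- A n)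
     \big[op/idx]_(1 <= k < d.+1 | gcdA A k d == 1) G d k =
  \big[op/idx]_(d <- A n)
     \big[op/idx]_(1 <= k < (n %/ d).+1 | gcdA A k (n %/ d) == 1) G (n %/ d) k.
Proof. by move=> n_gt0; rewrite -(perm_big _ (perm_Adiv_quo n_gt0)) big_map. Qed.

(** Write d = ef: by [Adiv_sub], e runs over the divisors of d in A(n), and for fixed e the
    multiples of e in A(n) are the ef with f in A(n/e). *)
Lemma exchange_big_Adiv (T : Type) (idx : T) (op : Monoid.com_law idx)
    (F : nat -> nat -> T) n : 0 < n ->
  \big[op/idx]_(d <- A n) \big[op/idx]_(e <- A d) F e (d %/ e) =
  \big[op/idx]_(e <- A n) \big[op/idx]_(f <- A (n %/ e)) F e f.
Proof.
move=> n_gt0; have reg_n := regular_divisor_system_at regA n_gt0.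
transitivity (\big[op/idx]_(d <- A n)
    \big[op/idx]_(e <- A n | e %| d) F e (d %/ e)).
  rewrite [LHS]big_seq [RHS]big_seq; apply: eq_bigr => d And.
  rewrite -[RHS]big_filter; apply: perm_big.
  apply: uniq_perm; rewrite ?filter_uniq ?fset_uniq //.
  by move=> e; rewrite mem_filter (Adiv_sub reg_n) // andbC.
under eq_bigr do rewrite big_mkcond.
rewrite exchange_big /= [LHS]big_seq [RHS]big_seq; apply: eq_bigr => e Ane.
rewrite -big_mkcond -big_filter (perm_big _ (perm_Adiv_multiples n_gt0 Ane)).
rewrite big_map.
by apply: eq_bigr => f _; rewrite mulKn // (Adiv_gt0 n_gt0 Ane).
Qed.

End RegularSystem.

Local Open Scope ring_scope.
Local Open Scope complex_scope.

(** * Roots of unity in Cartesian form *)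

Section Zeta.

Variable R : realType.

Lemma zetaX n j :
  zeta R n ^+ j = cos (2 * pi * j%:R / n%:R) +i* sin (2 * pi * j%:R / n%:R).
Proof.
elim: j => [|j IHj]; first by rewrite expr0 mulr0 mul0r cos0 sin0.
rewrite exprS IHj /zeta.
have -> : 2 * pi * j.+1%:R / n%:R = 2 * pi / n%:R + 2 * pi * j%:R / n%:R :> R.
  by rewrite -[j.+1%:R]natr1 mulrDr mulr1 mulrDl addrC.
rewrite cosD sinD; apply/eqP; rewrite eq_complex /= eqxx /=.
by rewrite addrC.
Qed.

Lemma zeta_quo n d k : (0 < n)%N -> (d %| n)%N ->
  zeta R n ^+ (d * k) = zeta R (n %/ d) ^+ k.
Proof.
move=> n_gt0 dn; rewrite !zetaX.
have d_neq0 : d%:R != 0 :> R by rewrite pnatr_eq0 -lt0n (dvdn_gt0 n_gt0 dn).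
suff -> : 2 * pi * (d * k)%:R / n%:R = 2 * pi * k%:R / (n %/ d)%:R :> R by [].
have q_neq0 : (n %/ d)%:R != 0 :> R.
  by rewrite pnatr_eq0 -lt0n divn_gt0 ?(dvdn_gt0 n_gt0 dn) // dvdn_leq.
by rewrite -{1}(divnK dn) !natrM; field; rewrite d_neq0 q_neq0.
Qed.

Lemma cos_neq1 (t : R) : 0 < t < 2 * pi -> cos t != 1.
Proof.
move=> /andP[t_gt0 t_lt]; have -> : t = (t / 2) *+ 2.
  by rewrite -mulr_natr divfK // pnatr_eq0.
(* Half-angle formula: cos t = 1 - 2 sin^2(t/2), where t/2 lies in (0, pi). *)
rewrite cos_mulr2n cos2sin2; apply/eqP.
have s_gt0 : 0 < sin (t / 2).
  by apply: sin_gt0_pi; rewrite divr_gt0 //= ltr_pdivrMr // mulrC.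
have := exprn_gt0 2 s_gt0; move: (sin _ ^+ 2) => s s2_gt0.
lra.
Qed.

(** For 0 < i < n the angle 2 pi i/n lies strictly between 0 and 2 pi, so the real part of zeta^i
    already differs from 1. *)
Lemma zeta_prim n : (0 < n)%N -> n.-primitive_root (zeta R n).
Proof.
move=> n_gt0; have n_neq0 : n%:R != 0 :> R by rewrite pnatr_eq0 -lt0n.
have ngt0R : 0 < n%:R :> R by rewrite ltr0n.
have zn1 : zeta R n ^+ n = 1.
  rewrite zetaX mulfK // mulrC mulr_natr cos2pi.
  by rewrite sin_mulr2n sinpi mulr0 mul0rn.
apply/andP; split=> //; apply/forallP => i; rewrite unity_rootE.
have [->|i_neq] := eqVneq i.+1 n; first by rewrite zn1 eqxx.
have i_lt : (i.+1 < n)%N by rewrite ltn_neqAle i_neq ltn_ord.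
apply/eqP/negbTE; rewrite zetaX eq_complex negb_and /= cos_neq1 //.
rewrite divr_gt0 ?mulr_gt0 ?pi_gt0 //=.
by rewrite ltr_pdivrMr // ltr_pM2l ?mulr_gt0 ?pi_gt0 // ltr_nat.
Qed.

Lemma prod_sub_zeta n (y : R[i]) : (0 < n)%N ->
  \prod_(1 <= j < n.+1) (y - zeta R n ^+ j) = y ^+ n - 1.
Proof.
move=> n_gt0; have zP := zeta_prim n_gt0.
have := congr1 (horner^~ y) (factor_Xn_sub_1 zP).
rewrite hornerD hornerN hornerXn hornerC horner_prod => <-.
under [RHS]eq_bigr do rewrite hornerXsubC.
(* The factorization of X^n - 1 runs over exponents 0 to n - 1, the goal over 1 to n; zeta^n =
   zeta^0 matches the end terms. *)
case: n n_gt0 zP => // n _ zP.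
rewrite big_nat_recr //= [RHS]big_nat_recl //= mulrC.
by rewrite (prim_expr_order zP) expr0 big_add1.
Qed.

Lemma sum_cos n : (0 < n)%N ->
  \sum_(1 <= j < n.+1) cos (2 * pi * j%:R / n%:R) = (n == 1)%:R :> R.
Proof.
move=> n_gt0; have zP := zeta_prim n_gt0.
have -> : \sum_(1 <= j < n.+1) cos (2 * pi * j%:R / n%:R) =
    complex.Re (\sum_(1 <= j < n.+1) zeta R n ^+ j).
  by rewrite raddf_sum; apply: eq_bigr => j _; rewrite zetaX.
have [->|n_neq1] := eqVneq n 1%N.
  by rewrite big_nat1 zetaX divr1 mulr1 mulrC mulr_natr cos2pi.
suff -> : \sum_(1 <= j < n.+1) zeta R n ^+ j = 0 by [].
have z_neq1 : zeta R n - 1 != 0.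
  rewrite subr_eq0 -[zeta R n]expr1 -(prim_order_dvd zP).
  by rewrite dvdn1.
(* Multiplied by zeta - 1, the sum telescopes to zeta^(n+1) - zeta = 0. *)
apply: (mulfI z_neq1); rewrite mulr0.
rewrite big_add1 /= mulr_sumr.
under eq_bigr do rewrite mulrBl mul1r -exprS.
by rewrite telescope_sumr // exprS (prim_expr_order zP) mulr1 expr1 subrr.
Qed.

End Zeta.

(** * The two divisor-product identities for x^n - 1 *)

Section CosineProduct.

Variables (R : realType) (A : nat -> {fset nat}).
Hypothesis regA : regular_system A.

(** The analogue for A of Ramanujan's sum c_n(1), in real form. *)
Definition ramanujanA (n : nat) : R :=
  \sum_(1 <= k < n.+1 | gcdA A k%:Z n == 1%N) cos (2 * pi * k%:R / n%:R).

Definition cos_prod (x : R) (n : nat) : R :=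
  \prod_(1 <= j < n.+1)
     powR (x ^+ gcdA A j%:Z n - 1) (cos (2 * pi * j%:R / n%:R)).

Lemma cos_quo n d k : (0 < n)%N -> d \in A n ->
  cos (2 * pi * (d * k)%:R / n%:R) = cos (2 * pi * k%:R / (n %/ d)%:R) :> R.
Proof.
move=> n_gt0 And.
by have := zeta_quo R k n_gt0 (Adiv_dvdn regA n_gt0 And); rewrite !zetaX => -[].
Qed.

Lemma sum_ramanujanA n : (0 < n)%N ->
  \sum_(d <- A n) ramanujanA d = (n == 1)%:R.
Proof.
move=> n_gt0; rewrite -(sum_cos R n_gt0) (big_gcdA_quo regA _ _ n_gt0).
rewrite /ramanujanA (big_gcdA regA _ (fun d k => cos (2 * pi * k%:R / d%:R))) //.
rewrite [LHS]big_seq [RHS]big_seq; apply: eq_bigr => d And.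
by apply: eq_bigr => k _; rewrite cos_quo.
Qed.

Lemma prod_PhiA n (y : R[i]) : (0 < n)%N ->
  \prod_(d <- A n) (PhiA R A d).[y] = y ^+ n - 1.
Proof.
move=> n_gt0; rewrite -(prod_sub_zeta y n_gt0) (big_gcdA_quo regA _ _ n_gt0).
transitivity (\prod_(d <- A n)
    \prod_(1 <= k < d.+1 | gcdA A k d == 1%N) (y - zeta R d ^+ k)).
  apply: eq_bigr => d _; rewrite horner_prod.
  by apply: eq_bigr => k _; rewrite hornerXsubC.
rewrite (big_gcdA regA _ (fun d k => y - zeta R d ^+ k)) //.
rewrite [LHS]big_seq [RHS]big_seq; apply: eq_bigr => d And.
by apply: eq_bigr => k _; rewrite zeta_quo // (Adiv_dvdn regA).
Qed.

Lemma powR_sum (a : R) (I : Type) (s : seq I) (P : pred I) (F : I -> R) :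
  0 < a -> powR a (\sum_(i <- s | P i) F i) = \prod_(i <- s | P i) powR a (F i).
Proof.
move=> a_gt0; rewrite /powR gt_eqF // mulr_suml expR_sum.
by apply: eq_bigr => i _.
Qed.

(** On the class j = dk the base x^d - 1 is constant and positive and the angle is 2 pi k/(n/d), so
    the exponents add up to c(n/d). *)
Lemma cos_prodE x n : (0 < n)%N -> 1 < x ->
  cos_prod x n = \prod_(d <- A n) powR (x ^+ d - 1) (ramanujanA (n %/ d)).
Proof.
move=> n_gt0 x_gt1; rewrite /cos_prod (big_gcdA_quo regA _ _ n_gt0).
rewrite [LHS]big_seq [RHS]big_seq; apply: eq_bigr => d And.
have d_gt0 := Adiv_gt0 regA n_gt0 And.
rewrite powR_sum ?subr_gt0 ?exprn_egt1 -?lt0n //.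
rewrite [LHS]big_nat_cond [RHS]big_nat_cond.
apply: eq_bigr => k /andP[/andP[k_gt0 _] gk].
suff /eqP -> : gcdA A (d * k)%N n == d by rewrite cos_quo.
by rewrite gcdA_eqE ?muln_gt0 ?d_gt0 // dvdn_mulr // mulKn.
Qed.

(** After exchanging the products, x^e - 1 has as exponent the sum of c over A(n/e), which is
    [n/e = 1]; only e = n survives. *)
Lemma prod_cos_prod x n : (0 < n)%N -> 1 < x ->
  \prod_(d <- A n) cos_prod x d = x ^+ n - 1.
Proof.
move=> n_gt0 x_gt1; have reg_n := regular_divisor_system_at regA n_gt0.
transitivity (\prod_(d <- A n) \prod_(e <- A d)
    powR (x ^+ e - 1) (ramanujanA (d %/ e))).
  rewrite [LHS]big_seq [RHS]big_seq; apply: eq_bigr => d And.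
  by rewrite cos_prodE // (Adiv_gt0 regA n_gt0).
rewrite (exchange_big_Adiv regA _ (fun e f => powR (x ^+ e - 1) (ramanujanA f))) //.
transitivity (\prod_(e <- A n) powR (x ^+ e - 1) (n %/ e == 1)%N%:R).
  rewrite [LHS]big_seq [RHS]big_seq; apply: eq_bigr => e Ane.
  rewrite -powR_sum ?sum_ramanujanA ?(Adiv_quo_gt0 regA) //.
  by rewrite subr_gt0 exprn_egt1 // -lt0n (Adiv_gt0 regA n_gt0).
rewrite (big_rem _ (Adiv_self reg_n)) /= divnn n_gt0 powRr1; last first.
  by rewrite subr_ge0 ltW // exprn_egt1 // -lt0n.
rewrite big1_seq ?mulr1 // => e; rewrite mem_rem_uniq ?fset_uniq // inE.
move=> /andP[_ /andP[e_neq Ane]]; case: eqVneq => [ne1|_]; last exact: powRr0.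
by rewrite -(divnK (Adiv_dvdn regA n_gt0 Ane)) ne1 mul1n eqxx in e_neq.
Qed.

End CosineProduct.

(** * Comparison of the two products by strong induction *)

Theorem theorem4 (R : realType) (A : nat -> {fset nat}) (n : nat) (x : R) :
  regular_system A -> (0 < n)%N -> 1 < x ->
  (PhiA R A n).[x%:C] =
  (\prod_(1 <= j < n.+1)
     powR (x ^+ gcdA A j%:Z n - 1) (cos (2 * pi * j%:R / n%:R)))%:C.
Proof.
move=> regA n_gt0 x_gt1; rewrite -/(cos_prod A x n).
elim/ltn_ind: n n_gt0 => n IHn n_gt0.
have reg_n := regular_divisor_system_at regA n_gt0.
have E : \prod_(d <- A n) (PhiA R A d).[x%:C] =
    \prod_(d <- A n) (cos_prod A x d)%:C.
  rewrite prod_PhiA // -rmorph_prod /= prod_cos_prod //.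
  by rewrite rmorphB rmorphXn rmorph1.
(* The product is x^n - 1, positive for x > 1; this licenses the final cancellation. *)
have Phi_neq0 : \prod_(d <- A n) (PhiA R A d).[x%:C] != 0.
  rewrite prod_PhiA // -rmorphXn -(rmorph1 (real_complex R)) -rmorphB.
  by rewrite fmorph_eq0 gt_eqF // subr_gt0 exprn_egt1 // -lt0n.
move: E Phi_neq0; rewrite !(big_rem _ (Adiv_self reg_n)) /=.
(* Every other d in A(n) is a proper divisor of n, so the induction hypothesis identifies the
   remaining factors. *)
have -> : \prod_(d <- rem n (A n)) (cos_prod A x d)%:C =
    \prod_(d <- rem n (A n)) (PhiA R A d).[x%:C].
  rewrite [LHS]big_seq [RHS]big_seq; apply: eq_bigr => d.
  rewrite mem_rem_uniq ?fset_uniq // inE => /andP[d_neq And].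
  rewrite IHn ?(Adiv_gt0 regA n_gt0 And) //.
  by rewrite ltn_neqAle d_neq dvdn_leq // (Adiv_dvdn regA).
by move=> E; rewrite mulf_eq0 negb_or => /andP[_ neq0]; apply: (mulIf neq0).
Qed.
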